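(* Let $A,B\in\mathcal{L}(\mathcal{H})$ be EP operators such that $\mathcal{R}(A)\subseteq\mathcal{R}(B)$. Then $B^\dagger A^\dagger$ is an $I,M$-weighted generalized inverse of $AB$ for every positive operator $M\in\mathcal{L}(\mathcal{H})$ of the form $M=M_1+M_2$, where $M_1,M_2\in\mathcal{L}(\mathcal{H})$ are positive, $\mathcal{R}(M_1)\subseteq\mathcal{R}(B^*A)$ and $\mathcal{R}(M_2)\subseteq\mathcal{N}(A(B^* )^\dagger)$.
   Context: $\mathcal{H}$ is a complex Hilbert space, $\mathcal{L}(\mathcal{H})$ is the algebra of bounded linear operators on $\mathcal{H}$, and $\mathcal{R}(T)$, $\mathcal{N}(T)$ denote range and nullspace. Positive means positive semidefinite. An operator $T\in\mathcal{L}(\mathcal{H})$ is EP if $\mathcal{R}(T)$ is closed and $\mathcal{R}(T)=\mathcal{R}(T^* )$. For $T\in\mathcal{L}(\mathcal{H})$ with closed range, $T^\dagger\in\mathcal{L}(\mathcal{H})$ is the Moore-Penrose inverse, i.e. the unique $X$ with $TXT=T$, $XTX=X$, $(TX)^*=TX$, $(XT)^*=XT$. For positive $M,N\in\mathcal{L}(\mathcal{H})$ and $T\in\mathcal{L}(\mathcal{H})$ with closed range, an operator $X\in\mathcal{L}(\mathcal{H})$ is an $M,N$-weighted generalized inverse of $T$ if $TXT=T$, $XTX=X$, $(MTX)^*=MTX$ and $(NXT)^*=NXT$. Thus an $I,M$-weighted generalized inverse has first weight the identity $I$ and second weight $M$. *)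

(* Defs.v *)
From HB Require Import structures.
From mathcomp Require Import all_boot all_order all_algebra.
From mathcomp Require Import sesquilinear complex.
From mathcomp Require Import boolp classical_sets functions reals topology.
From mathcomp Require Import normedtype sequences.

Set Implicit Arguments.
Unset Strict Implicit.
Unset Printing Implicit Defensive.

Import Order.TTheory GRing.Theory Num.Theory.
Import numFieldNormedType.Exports.

Local Open Scope classical_set_scope.
Local Open Scope ring_scope.
Local Open Scope complex_scope.

(* Complex Hilbert spaces: the inner product is linear in its first argument
   and conjugate-linear in its second one. *)
HB.mixin Record CompleteNormedModule_isHilbert (R : realType) H
    of CompleteNormedModule R[i] H := {
  dotp : {dot H for (@Num.conj R[i])} ;
  sqr_normE : forall x : H, `|x| ^+ 2 = dotp x x
}.

#[short(type="hilbertType")]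
HB.structure Definition Hilbert (R : realType) :=
  {H of CompleteNormedModule R[i] H & CompleteNormedModule_isHilbert R H}.

Section Operators.
Context {R : realType} {H : hilbertType R}.
Implicit Types (x y : H) (T X M N : H -> H).

Definition bounded_operator T :=
  linear T /\ exists k : R[i], forall x, `|T x| <= k * `|x|.

(* The set is a singleton when T is bounded, by the Riesz representation
   theorem. *)
Definition adjoint T : H -> H :=
  get [set S | bounded_operator S /\ forall x y, dotp (T x) y = dotp x (S y)].

Definition nullspace T : set H := T @^-1` [set 0].

(* In R[i], 0 <= z means that z is real and nonnegative. *)
Definition positive_operator T :=
  bounded_operator T /\ forall x, 0 <= dotp (T x) x.

Definition EP T := closed (range T) /\ range T = range (adjoint T).

Definition is_MP_inverse T X :=
  [/\ bounded_operator X,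
      T \o X \o T = T,
      X \o T \o X = X,
      adjoint (T \o X) = T \o X
    & adjoint (X \o T) = X \o T].

(* The set is a singleton when T is bounded with closed range. *)
Definition MP_inverse T : H -> H := get [set X | is_MP_inverse T X].

Record is_weighted_ginv M N T X : Prop := {
  wginv_posl : positive_operator M ;
  wginv_posr : positive_operator N ;
  wginv_dom : bounded_operator T ;
  wginv_closed : closed (range T) ;
  wginv_bounded : bounded_operator X ;
  wginv_TXT : T \o X \o T = T ;
  wginv_XTX : X \o T \o X = X ;
  wginv_adjl : adjoint (M \o T \o X) = M \o T \o X ;
  wginv_adjr : adjoint (N \o X \o T) = N \o X \o T
}.

End Operators.

(* Main.v *)
Require Import Defs.
From mathcomp Require Import all_boot all_order all_algebra.
From mathcomp Require Import sesquilinear complex.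
From mathcomp Require Import boolp classical_sets functions reals topology.
From mathcomp Require Import normedtype sequences.
From mathcomp Require Import ring lra.

(** Write [A'] and [B'] for the Moore-Penrose inverses. For an EP operator,
    [A A' = A' A] is the orthogonal projection onto the range of [A]. Since
    [A' y] lies in [R(A)], a subspace of [R(B)], it is fixed by [B B'], so that
    [(A B) (B' A') = A A']. This projection is self-adjoint, and the two
    generalized inverse identities for [A B] and [B' A'] follow from it. The
    range of [A B] is all of [R(A)], hence closed.

    For the second weight, [Q = (B' A') (A B) = B' (A' A) B] is an oblique
    projection. Write [X^H] for the adjoint of [X]. Then
    [Q^H = B^H (A' A) B'^H] is the identity on [R(B^H A)] and, because
    [B'^H] is the Moore-Penrose inverse of [B^H], it vanishes on the nullspace
    of [A] composed with that inverse. Thus [Q^H M1 = M1] and [Q^H M2 = 0], so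
    that [M Q], the adjoint of [Q^H M], is [M1], which is self-adjoint because
    it is positive on a complex space ([MP_inverse_product_weight]).

    The definitions of [adjoint] and [MP_inverse] pick an element of a set, so
    these sets must be shown to be nonempty. Adjoints come from the Riesz
    representation theorem ([riesz]), hence from projections onto closed
    subspaces ([orthogonal_projection]). For an EP operator [T], the kernel is
    the orthogonal complement of [R(T^H) = R(T)], so [T] maps [R(T)] bijectively
    onto itself, and the inverse of this bijection, extended by 0 on the kernel,
    is the Moore-Penrose inverse ([EP_inverse]). Its boundedness is an instance
    of the uniform boundedness principle ([uniform_boundedness]). *)

Import Order.TTheory GRing.Theory Num.Theory.
Local Open Scope classical_set_scope.
Local Open Scope ring_scope.

Set Implicit Arguments.
Unset Strict Implicit.

(** * The real inner product and norm underlying a complex Hilbert space *)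

Section RealStructure.
Context {R : realType} {H : hilbertType R}.
Implicit Types (x y z u v w : H) (T : H -> H).

Lemma dotpC x y : dotp x y = (dotp y x)^*%R.
Proof. by rewrite (hermC (dotp : {dot H for _})) expr0 mul1r. Qed.

Lemma dotpZl (a : R[i]) x y : dotp (a *: x) y = a * dotp x y.
Proof. exact: linearZl_LR. Qed.

Lemma dotpZr (a : R[i]) x y : dotp x (a *: y) = a^*%R * dotp x y.
Proof. exact: linearZr_LR. Qed.

Lemma dotp_inj x y : (forall z, dotp z x = dotp z y) -> x = y.
Proof.
move=> h; apply/eqP; rewrite -subr_eq0 -(dnorm_eq0 dotp) linearBr /= h.
by rewrite subrr.
Qed.

(** The norm of [H] takes values in the partially ordered field [R[i]]; these
    real-valued versions give access to the total order and to the suprema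
    and infima of [R]. *)
Definition nrm x : R := complex.Re `|x|.
Definition rdot x y : R := complex.Re (dotp x y).

Lemma nrmE x : (nrm x)%:C%C = `|x|.
Proof. by apply: RRe_real; exact: normr_real. Qed.

Lemma rdotC x y : rdot x y = rdot y x.
Proof. by rewrite /rdot dotpC; case: (dotp y x). Qed.

Lemma rdotDl x y z : rdot (x + y) z = rdot x z + rdot y z.
Proof. by rewrite /rdot linearDl raddfD. Qed.

Lemma rdotBl x y z : rdot (x - y) z = rdot x z - rdot y z.
Proof. by rewrite /rdot linearBl raddfB. Qed.

Lemma rdotZl (a : R) x y : rdot (a%:C%C *: x) y = a * rdot x y.
Proof.
by rewrite /rdot dotpZl; case: (dotp x y) => p q /=; rewrite mul0r subr0.
Qed.

Lemma rdotDr z x y : rdot z (x + y) = rdot z x + rdot z y.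
Proof. by rewrite rdotC rdotDl !(rdotC z). Qed.

Lemma rdotBr z x y : rdot z (x - y) = rdot z x - rdot z y.
Proof. by rewrite rdotC rdotBl !(rdotC z). Qed.

Lemma rdotZr (a : R) x y : rdot x (a%:C%C *: y) = a * rdot x y.
Proof. by rewrite rdotC rdotZl rdotC. Qed.

Lemma rdotxx x : rdot x x = nrm x ^+ 2.
Proof. by rewrite /rdot -sqr_normE -nrmE -rmorphXn. Qed.

Lemma nrm_ge0 x : 0 <= nrm x.
Proof. by rewrite -ler0c nrmE normr_ge0. Qed.

Lemma nrm0 : nrm 0 = 0.
Proof. by rewrite /nrm normr0. Qed.

Lemma nrm_gt0 x : x != 0 -> 0 < nrm x.
Proof.
move=> x0; rewrite lt_def nrm_ge0 andbT; apply: contra x0 => /eqP h.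
by rewrite -normr_eq0 -nrmE h.
Qed.

Lemma nrmD x y : nrm (x + y) <= nrm x + nrm y.
Proof. by rewrite -lecR rmorphD /= !nrmE ler_normD. Qed.

Lemma nrmB x y : nrm (x - y) = nrm (y - x).
Proof. by rewrite /nrm distrC. Qed.

Lemma nrmZ (a : R) x : nrm (a%:C%C *: x) = `|a| * nrm x.
Proof.
apply: complexI; rewrite rmorphM /= !nrmE normrZ normc_def /=.
by rewrite expr0n addr0 sqrtr_sqr.
Qed.

Lemma sqr_nrmB x y : nrm (x - y) ^+ 2 = nrm x ^+ 2 - 2 * rdot x y + nrm y ^+ 2.
Proof. by rewrite -!rdotxx !(rdotBl, rdotBr) (rdotC y x); ring. Qed.

Lemma rdot_CauchySchwarz x y : `|rdot x y| <= nrm x * nrm y.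
Proof.
have [->|y0] := eqVneq y 0.
  by rewrite /rdot linear0r nrm0 normr0 mulr0.
have ny := nrm_gt0 y0.
(* |y|^2 times the component of x orthogonal to y *)
have key : 0 <= nrm (((nrm y ^+ 2)%:C%C) *: x - (rdot x y)%:C%C *: y) ^+ 2.
  exact: sqr_ge0.
rewrite -rdotxx !(rdotBl, rdotBr, rdotZl, rdotZr) !rdotxx (rdotC y x) in key.
rewrite -ler_sqr ?nnegrE ?mulr_ge0 ?nrm_ge0 // real_normK ?num_real //.
rewrite -(ler_pM2l (exprn_gt0 2 ny)); lra.
Qed.

Lemma rdot_imaginary x y : rdot x ('i%C *: y) = complex.Im (dotp x y).
Proof.
rewrite /rdot dotpZr; case: (dotp x y) => p q /=.
by rewrite mul0r mulN1r opprK add0r.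
Qed.

Lemma dotp_eq0 x y : rdot x y = 0 -> rdot x ('i%C *: y) = 0 -> dotp x y = 0.
Proof. by rewrite rdot_imaginary /rdot; case: (dotp x y) => p q /= -> ->. Qed.

Lemma closed_approx (V : set H) : closed V ->
  forall l, (forall e : R, 0 < e -> exists2 v, V v & nrm (l - v) < e) -> V l.
Proof.
move=> cV l h; apply: cV => B /nbhs_normP [e /= e0 eB].
have [v Vv lv] : exists2 v, V v & nrm (l - v) < complex.Re e.
  by apply: h; move: e0; rewrite ltcE => /andP[].
exists v; split => //; apply: eB; rewrite /= -nrmE.
rewrite -(RRe_real (gtr0_real e0)) ltcR; exact: lv.
Qed.

Lemma cauchy_limit (u : nat -> H) :
  (forall e : R, 0 < e ->
    exists N, forall n, (N <= n)%N -> nrm (u N - u n) < e) ->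
  exists l, forall e : R, 0 < e ->
    exists N, forall n, (N <= n)%N -> nrm (l - u n) < e.
Proof.
move=> h.
have : cvg (u @ \oo).
  apply: cauchy_cvg; apply: cauchy_exP => e e0.
  have [|N hN] := h (complex.Re e); first by move: e0; rewrite ltcE => /andP[].
  exists (u N); exists N => // n /= Nn.
  rewrite -ball_normE /ball_ /= -nrmE -(RRe_real (gtr0_real e0)) ltcR.
  exact: hN.
move=> /cvg_ex [l ul]; exists l => e e0.
have /cvgr_dist_lt : u @ \oo --> l by [].
move=> /(_ (e%:C%C)); rewrite ltcR => /(_ e0) [N _ hN].
by exists N => n Nn; rewrite -ltcR nrmE; exact: hN.
Qed.

Lemma boundedP T : bounded_operator T <->
  linear T /\ exists2 C : R, 0 <= C & forall x, nrm (T x) <= C * nrm x.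
Proof.
split=> -[lT [k]].
  (* The given constant k may fail to be real when H is trivial. *)
  move=> hk; split => //; exists `|complex.Re k| => // x.
  have Rek : complex.Re (k * (nrm x)%:C%C) = complex.Re k * nrm x.
    by case: (k) => p q /=; rewrite mulr0 subr0.
  have := hk x; rewrite -!nrmE lecE Rek /= => /andP[_ /le_trans]; apply.
  by rewrite ler_wpM2r ?nrm_ge0 ?ler_norm.
move=> _ hk; split => //; exists (k%:C)%C => x.
by rewrite -!nrmE -rmorphM lecR.
Qed.

End RealStructure.

(** * Projection onto a closed subspace *)

Section Projection.
Context {R : realType} {H : hilbertType R}.
Implicit Types (x y v w : H) (V : set H).

(** The parallelogram identity for [x - v] and [x - w]. Here [V] will be a
    subspace containing [v] and [w], hence also their midpoint. *)
Lemma apollonius x v w :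
  nrm (v - w) ^+ 2 = 2 * nrm (x - v) ^+ 2 + 2 * nrm (x - w) ^+ 2
    - 4 * nrm (x - (2^-1)%:C%C *: (v + w)) ^+ 2.
Proof.
rewrite -!rdotxx !(rdotBl, rdotBr, rdotZl, rdotZr, rdotDl, rdotDr).
by rewrite !(rdotC v x) !(rdotC w x) !(rdotC w v); field.
Qed.

Lemma linear_le_sqr0 (c q : R) : (forall t, 2 * t * c <= t ^+ 2 * q) -> c = 0.
Proof.
move=> h; apply/eqP; rewrite -sqrf_eq0 eq_le sqr_ge0 andbT.
have q0 : 0 <= q by have := h 1; have := h (-1); lra.
have /(_ (c / (q + 1))) := h.
have -> : 2 * (c / (q + 1)) * c = 2 * c ^+ 2 / (q + 1) by field; lra.
have -> : (c / (q + 1)) ^+ 2 * q = c ^+ 2 * q / (q + 1) / (q + 1).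
  by field; lra.
have q1 : 0 < q + 1 by lra.
rewrite ler_pM2r ?invr_gt0 // ler_pdivlMr //.
have := sqr_ge0 c; nra.
Qed.

(** A sequence in [V] whose distance to [x] tends to the infimum is Cauchy by
    the parallelogram identity, and its limit is the projection: at a minimum
    the first-order variation of the squared distance along [V] vanishes. *)
Theorem orthogonal_projection V : closed V -> V 0 ->
    (forall a x y, V x -> V y -> V (a *: x + y)) ->
  forall x, exists2 p, V p & forall v, V v -> dotp (x - p) v = 0.
Proof.
move=> cV V0 lV x.
have VZ a v : V v -> V (a *: v) by move=> Vv; rewrite -[_ *: _]addr0; apply: lV.
have VD v w : V v -> V w -> V (v + w).
  by move=> Vv Vw; rewrite -[v]scale1r; apply: lV.
pose D := [set nrm (x - v) ^+ 2 | v in V].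
pose d := inf D.
have Dinf : has_inf D.
  split; first by exists (nrm (x - 0) ^+ 2), 0.
  by exists 0 => _ [v _ <-]; apply: sqr_ge0.
have dle v : V v -> d <= nrm (x - v) ^+ 2.
  by move=> Vv; apply: ge_inf; [case: Dinf | exists v].
have /choice[u hu] (n : nat) :
    exists v, V v /\ nrm (x - v) ^+ 2 < d + n.+1%:R^-1.
  have [] := @inf_adherent _ D (n.+1%:R^-1); rewrite ?invr_gt0 ?ltr0n //.
  by move=> _ [v Vv <-] h; exists v.
have small (e : R) : 0 < e -> exists N, forall n, (N <= n)%N -> n.+1%:R^-1 < e.
  move=> e0; exists (Num.truncn e^-1) => n Nn.
  rewrite -[ltRHS]invrK ltf_pV2 ?posrE ?invr_gt0 ?ltr0n //.
  by rewrite (lt_le_trans (truncnS_gt _)) // ler_nat ltnS.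
have [|p up] := @cauchy_limit _ _ u.
  move=> e e0; have [|N hN] := small (e ^+ 2 / 4).
    by rewrite divr_gt0 ?exprn_gt0.
  exists N => n Nn; rewrite -ltr_sqr ?nnegrE ?nrm_ge0 ?ltW // (apollonius x).
  have := dle _ (VZ (2^-1)%:C%C _ (VD _ _ (proj1 (hu N)) (proj1 (hu n)))).
  have := proj2 (hu n); have := proj2 (hu N).
  have := hN _ Nn; have := hN _ (leqnn N).
  move: (N.+1%:R^-1) (n.+1%:R^-1) => a b; lra.
have Vp : V p.
  apply: closed_approx => // e /up [N hN]; exists (u N); last exact: hN.
  by case: (hu N).
exists p => //.
suff key v : V v -> rdot (x - p) v = 0.
  by move=> v Vv; apply: dotp_eq0; apply: key => //; apply: VZ.
move=> Vv; apply: (@linear_le_sqr0 _ (nrm v ^+ 2)) => t.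
(* The minimality of p is used only through u n, up to an error e. *)
apply/ler_addgt0Pr => e e0.
have C0 : 0 < 2 * `|t| * nrm v + 1 by rewrite ltr_wpDl // !mulr_ge0 // nrm_ge0.
have [|N1 hN1] := small (e / 2); first lra.
have [|N2 hN2] := up (e / 2 / (2 * `|t| * nrm v + 1)).
  by rewrite !divr_gt0.
have {hN1} := hN1 _ (leq_maxl N1 N2); have {hN2} := hN2 _ (leq_maxr N1 N2).
set n := maxn _ _; rewrite ltr_pdivlMr // => pu ne.
have [Vu un] := hu n; move: (n.+1%:R^-1) ne un => a ne un.
have := dle _ (VD _ _ (VZ t%:C%C _ Vv) Vu).
rewrite [_ *: _ + _]addrC opprD addrA sqr_nrmB nrmZ rdotZr exprMn.
rewrite real_normK ?num_real //.
have -> : rdot (x - p) v = rdot (x - u n) v - rdot (p - u n) v.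
  by rewrite !rdotBl; ring.
have : - (t * rdot (p - u n) v) <= `|t| * (nrm (p - u n) * nrm v).
  rewrite (le_trans (ler_norm _)) // normrN normrM ler_wpM2l //.
  exact: rdot_CauchySchwarz.
have := nrm_ge0 (p - u n); lra.
Qed.

End Projection.

(** * Weakly bounded sets are bounded *)

Section UniformBoundedness.
Context {R : realType} {H : hilbertType R}.
Implicit Types (x z w : H).

(** Of the two points [x + z] and [x - z], with [z] of norm [r] in the direction
    of [w], the one on the same side as [x] will do. *)
Lemma rdot_push x w (r : R) : 0 <= r ->
  exists2 x', nrm (x - x') <= r & r * nrm w <= `|rdot x' w|.
Proof.
move=> r0; have [->|w0] := eqVneq w 0.
  by exists x; rewrite ?subrr nrm0 // mulr0 normr_ge0.
have nw := nrm_gt0 w0.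
pose z : H := (r / nrm w)%:C%C *: w.
have nz : nrm z = r.
  by rewrite nrmZ ger0_norm ?divr_ge0 ?nrm_ge0 // divfK ?gt_eqF.
have zw : rdot z w = r * nrm w by rewrite rdotZl rdotxx; field; rewrite gt_eqF.
have [xw|xw] := leP 0 (rdot x w).
  exists (x + z); first by rewrite nrmB addrC addKr nz.
  by rewrite rdotDl zw (le_trans _ (ler_norm _)) // lerDr.
exists (x - z); first by rewrite opprB addrC subrK nz.
rewrite rdotBl zw -normrN opprB (le_trans _ (ler_norm _)) //.
by rewrite lerBrDr gerDl ltW.
Qed.

(** A gliding hump: if [w n] in [W] have norms growing faster than [n * 3 ^ n],
    then steps of length [3 ^ - n.+1], each chosen so that the new point has a
    large inner product with [w n], converge to a point [l], and the later
    steps are together too short to make [rdot l (w n)] small again. *)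
Theorem uniform_boundedness (W : set H) :
  (forall z, exists M : R, forall w, W w -> `|rdot z w| <= M) ->
  exists C : R, forall w, W w -> nrm w <= C.
Proof.
move=> Wb; apply: contrapT => /forallNP nW.
pose r n : R := (3 ^+ n)^-1.
have r_gt0 n : 0 < r n by rewrite invr_gt0 exprn_gt0.
have rS n : r n = 3 * r n.+1.
  by rewrite /r exprS invfM mulrA divff ?mul1r // pnatr_eq0.
have small (e : R) : 0 < e -> exists n, r n < e.
  move=> e0; exists (Num.truncn e^-1).+1.
  rewrite -[ltRHS]invrK ltf_pV2 ?posrE ?invr_gt0 ?exprn_gt0 //.
  by rewrite (lt_trans (truncnS_gt _)) // -natrX ltr_nat ltn_expl.
have /choice[w hw] (n : nat) : exists w, W w /\ n%:R * 2 / r n.+1 < nrm w.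
  by have /existsNP[w /not_implyP[Ww /negP]] := nW (n%:R * 2 / r n.+1);
    rewrite -ltNge; exists w.
have /choice[f hf] (nx : nat * H) : exists x',
    nrm (nx.2 - x') <= r nx.1.+1 /\
    r nx.1.+1 * nrm (w nx.1) <= `|rdot x' (w nx.1)|.
  have [x' ? ?] := rdot_push nx.2 (w nx.1) (ltW (r_gt0 nx.1.+1)).
  by exists x'.
pose fix x n := if n is m.+1 then f (m, x m) else 0.
have xnk n k : nrm (x n - x (n + k)%N) <= (r n - r (n + k)%N) / 2.
  elim: k => [|k IH]; first by rewrite addn0 !subrr nrm0 mul0r.
  have := nrmD (x n - x (n + k)%N) (x (n + k)%N - x (n + k).+1).
  rewrite addrA subrK addnS; have [/= + _] := hf ((n + k)%N, x (n + k)%N).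
  have := rS (n + k)%N; lra.
have xr n m : (n <= m)%N -> nrm (x n - x m) <= r n / 2.
  move=> /subnKC <-; have := xnk n (m - n)%N.
  have := r_gt0 (n + (m - n))%N; lra.
have [|l xl] := @cauchy_limit _ _ x.
  move=> e /small[N rN]; exists N => n /xr; have := r_gt0 N; lra.
have lx n : nrm (l - x n) <= r n / 2.
  apply/ler_addgt0Pr => e /xl[N hN].
  have := nrmD (l - x (maxn N n)) (x (maxn N n) - x n).
  rewrite addrA subrK (nrmB (x (maxn N n))) => h; move: h.
  have := hN _ (leq_maxl N n); have := xr _ _ (leq_maxr N n); lra.
have [M hM] := Wb l.
pose n := Num.truncn M; have := truncnS_gt M; rewrite -/n => Mn.
have [Ww wn] := hw n.+1; have /= [_ xw] := hf (n.+1, x n.+1).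
have {wn} : n.+1%:R * 2 < nrm (w n.+1) * r n.+2 by rewrite -ltr_pdivrMr.
have := hM _ Ww; have := rdot_CauchySchwarz (l - x n.+2) (w n.+1).
have : nrm (l - x n.+2) * nrm (w n.+1) <= r n.+2 / 2 * nrm (w n.+1).
  by rewrite ler_wpM2r ?nrm_ge0.
have := ler_normB (rdot l (w n.+1)) (rdot (l - x n.+2) (w n.+1)).
rewrite -rdotBl opprB addrC subrK.
move: xw Mn; rewrite /=; move: (n.+1%:R) => b; lra.
Qed.

End UniformBoundedness.

(** * Adjoints *)

Section Adjoint.
Context {R : realType} {H : hilbertType R}.
Implicit Types (x y z v : H) (T S : H -> H).

Lemma linear_morph T : linear T ->
  [/\ T 0 = 0, forall x y, T (x + y) = T x + T y,
      forall x y, T (x - y) = T x - T y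
    & forall a x, T (a *: x) = a *: T x].
Proof.
move=> lT; have TD x y : T (x + y) = T x + T y.
  by rewrite -[x in LHS]scale1r lT scale1r.
have T0 : T 0 = 0 by apply: (@addrI _ (T 0)); rewrite -TD !addr0.
have TZ a x : T (a *: x) = a *: T x by rewrite -[_ *: x]addr0 lT T0 addr0.
by split => // x y; rewrite TD -scaleN1r TZ scaleN1r.
Qed.

Lemma bounded_comp T S :
  bounded_operator T -> bounded_operator S -> bounded_operator (T \o S).
Proof.
move=> /boundedP[lT [C C0 TC]] /boundedP[lS [D D0 SD]]; apply/boundedP; split.
  by move=> a x y /=; rewrite lS lT.
exists (C * D) => [|x /=]; first exact: mulr_ge0.
by rewrite (le_trans (TC _)) // -mulrA ler_wpM2l.
Qed.

Lemma closed_dotp_kernel T y :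
  bounded_operator T -> closed [set x | dotp (T x) y = 0].
Proof.
move=> /boundedP[lT [C C0 TC]]; have [_ _ TB _] := linear_morph lT.
have key l y' :
    (forall e : R, 0 < e -> exists2 v, rdot (T v) y' = 0 & nrm (l - v) < e) ->
    rdot (T l) y' = 0.
  move=> h; apply/eqP; rewrite -normr_le0; apply/ler_addgt0Pr => e e0.
  rewrite add0r.
  have D0 : 0 < C * nrm y' + 1 by rewrite ltr_wpDl // mulr_ge0 // nrm_ge0.
  have [|v Tv lv] := h (e / (C * nrm y' + 1)); first exact: divr_gt0.
  have -> : rdot (T l) y' = rdot (T (l - v)) y' by rewrite TB rdotBl Tv subr0.
  rewrite (le_trans (rdot_CauchySchwarz _ _)) //.
  rewrite (le_trans (ler_wpM2r (nrm_ge0 _) (TC _))) //.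
  move: lv; rewrite ltr_pdivlMr //; have := nrm_ge0 (l - v); nra.
move=> l ll.
have app (e : R) : 0 < e -> exists2 v, dotp (T v) y = 0 & nrm (l - v) < e.
  move=> e0; have [|v [Kv lv]] := ll (ball l e%:C%C).
    by apply: nbhsx_ballx; rewrite ltcR.
  by exists v => //; move: lv; rewrite -ball_normE /ball_ /= -nrmE ltcR.
apply: dotp_eq0; apply: key => e /app[v Tv lv]; exists v => //.
  by rewrite /rdot Tv.
by rewrite rdot_imaginary Tv.
Qed.

(** The Riesz representation theorem for the functional sending [x] to
    [dotp (T x) y]: a vector [u] orthogonal to its closed kernel, suitably
    scaled, represents it. *)
Lemma riesz T y : bounded_operator T ->
  exists z, forall x, dotp (T x) y = dotp x z.
Proof.
move=> bT; have [lT _] := bT; have [T0 TD TB TZ] := linear_morph lT.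
pose K : set H := [set x | dotp (T x) y = 0].
have [Kall|/existsNP[x0 Kx0]] := pselect (forall x, K x).
  by exists 0 => x; rewrite Kall linear0r.
have [|a u v Ku Kv|p Kp pK] :=
  orthogonal_projection (closed_dotp_kernel (y := y) bT) _ _ x0.
- by rewrite /= T0 linear0l.
- by rewrite /= lT linearDl /= dotpZl Ku Kv mulr0 addr0.
pose u := x0 - p; pose f x := dotp (T x) y.
have fu : f u != 0 by rewrite /f TB linearBl /= Kp subr0; apply/eqP.
have uu : dotp u u != 0.
  by apply: contra fu; rewrite dnorm_eq0 => /eqP ->; rewrite /f T0 linear0l.
exists ((f u / dotp u u)^*%R *: u) => x.
rewrite dotpZr conjCK.
(* x is a multiple of u modulo the kernel *)
have : dotp u (x - (f x / f u) *: u) = 0.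
  apply: pK; rewrite /= TB TZ linearBl /= dotpZl -/(f x) -/(f u) divfK //.
  by rewrite subrr.
rewrite dotpC linearBl /= dotpZl => /(congr1 Num.conj); rewrite conjCK conjC0.
move/eqP; rewrite subr_eq0 => /eqP ->.
by rewrite [RHS]mulrC mulrA mulrAC mulfK // divfK.
Qed.

Lemma adjoint_ex T : bounded_operator T ->
  exists S, bounded_operator S /\ forall x y, dotp (T x) y = dotp x (S y).
Proof.
move=> bT; have /choice[S hS] y := riesz y bT; exists S; split=> //.
have /boundedP[_ [C C0 TC]] := bT; apply/boundedP; split.
  move=> a x y; apply: dotp_inj => z.
  by rewrite -hS !linearDr /= !dotpZr !hS.
exists C => // y; have [->|Sy] := eqVneq (S y) 0.
  by rewrite nrm0 mulr_ge0 // nrm_ge0.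
rewrite -(ler_pM2l (nrm_gt0 Sy)) -expr2 -rdotxx /rdot -hS.
rewrite (le_trans (ler_norm _)) // (le_trans (rdot_CauchySchwarz _ _)) //.
by rewrite mulrCA mulrA ler_wpM2r ?nrm_ge0.
Qed.

Lemma adjointP T : bounded_operator T ->
  bounded_operator (adjoint T) /\
  forall x y, dotp (T x) y = dotp x (adjoint T y).
Proof. by move=> bT; exact: (getPex (adjoint_ex bT)). Qed.

Lemma adjoint_uniq T S : bounded_operator T ->
  (forall x y, dotp (T x) y = dotp x (S y)) -> adjoint T = S.
Proof.
move=> /adjointP[_ aT] h; apply: funext => y; apply: dotp_inj => x.
by rewrite -aT h.
Qed.

Lemma adjointK T : bounded_operator T -> adjoint (adjoint T) = T.
Proof.
move=> bT; have [bA aT] := adjointP bT; apply: adjoint_uniq => // x y.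
by rewrite dotpC -aT -dotpC.
Qed.

Lemma adjoint_comp T S : bounded_operator T -> bounded_operator S ->
  adjoint (T \o S) = adjoint S \o adjoint T.
Proof.
move=> bT bS; apply: adjoint_uniq; first exact: bounded_comp.
by move=> x y /=; rewrite (adjointP bT).2 (adjointP bS).2.
Qed.

Lemma kernel_orthogonal_range_adjoint T x : bounded_operator T ->
  T x = 0 <-> forall v, range (adjoint T) v -> dotp x v = 0.
Proof.
move=> bT; have [_ aT] := adjointP bT; split=> [Tx _ [y _ <-]|h].
  by rewrite -aT Tx linear0l.
by apply/eqP; rewrite -(dnorm_eq0 dotp) aT h //; exists (T x).
Qed.

(** Polarization: the defect [g] of symmetry is sesquilinear and vanishes on
    the diagonal, because [dotp (T u) u] is real; evaluating it at [x + y] and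
    [x + 'i *: y] makes it vanish everywhere. *)
Lemma positive_symmetric T : positive_operator T ->
  forall x y, dotp (T x) y = dotp x (T y).
Proof.
move=> [[lT _] pT] x y; have [_ TD _ TZ] := linear_morph lT.
pose g u v := dotp (T u) v - dotp u (T v).
have gxx u : dotp (T u) u = dotp u (T u).
  by rewrite [RHS]dotpC geC0_conj.
have g0 u : g u u = 0 by rewrite /g gxx subrr.
have gD : g x y + g y x = 0.
  have := g0 (x + y); rewrite /g TD !linearDl !linearDr /= => h.
  by rewrite -[RHS]h !gxx; ring.
have gB : g x y - g y x = 0.
  have := g0 (x + 'i *: y).
  rewrite /g TD TZ !linearDl !linearDr /= !(dotpZl, dotpZr) conjCi !gxx => h.
  have : - 'i * (g x y - g y x) = 0 by rewrite -[RHS]h /g; ring.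
  by move/eqP; rewrite mulf_eq0 oppr_eq0 (negPf (neq0Ci _)) => /eqP.
apply/eqP; rewrite -subr_eq0 -/(g x y).
move: gD => /eqP; rewrite addr_eq0 => /eqP e; move: gB.
by rewrite -e => /eqP; rewrite -mulr2n mulrn_eq0.
Qed.

End Adjoint.

(** * Moore-Penrose inverses of EP operators *)

Section MoorePenrose.
Context {R : realType} {H : hilbertType R}.
Implicit Types (x y z v w : H) (T X Y P : H -> H) (V : set H).

Lemma range_subspace T : linear T -> range T 0 /\
  (forall a x y, range T x -> range T y -> range T (a *: x + y)).
Proof.
move=> lT; have [T0 _ _ _] := linear_morph lT; split; first by exists 0.
by move=> a _ _ [x _ <-] [y _ <-]; exists (a *: x + y) => //; rewrite lT.
Qed.

Lemma EP_adjoint T : bounded_operator T -> EP T -> EP (adjoint T).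
Proof. by move=> bT [cT rT]; split; rewrite ?adjointK // -rT. Qed.

Lemma orthogonal_projector V : closed V -> V 0 ->
    (forall a x y, V x -> V y -> V (a *: x + y)) ->
  exists P, [/\ forall x, V (P x), forall x, V x -> P x = x,
    forall x v, V v -> dotp (x - P x) v = 0,
    forall x y, dotp (P x) y = dotp x (P y)
    & forall x, nrm (P x) <= nrm x].
Proof.
move=> cV V0 lV.
have /choice[P hP] x : exists p, V p /\ forall v, V v -> dotp (x - p) v = 0.
  by have [p Vp xp] := orthogonal_projection cV V0 lV x; exists p.
have VP x : V (P x) by case: (hP x).
have oP x v : V v -> dotp (x - P x) v = 0 by case: (hP x) => _; apply.
have PV x : V x -> P x = x.
  move=> Vx; apply/esym/eqP; rewrite -subr_eq0 -(dnorm_eq0 dotp) oP //.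
  by rewrite addrC -scaleN1r; apply: lV.
have dP x y : dotp (P x) y = dotp x (P y).
  have := oP x _ (VP y); rewrite linearBl /= => /eqP; rewrite subr_eq0.
  move=> /eqP ->; have := oP y _ (VP x); rewrite dotpC linearBr /= => /eqP.
  by rewrite conjC_eq0 subr_eq0 => /eqP ->.
exists P; split=> // x.
have [->|Px] := eqVneq (P x) 0; first by rewrite nrm0 nrm_ge0.
rewrite -(ler_pM2r (nrm_gt0 Px)) -expr2 -rdotxx /rdot dP PV //.
by rewrite (le_trans (ler_norm _)) // rdot_CauchySchwarz.
Qed.

(** For [y] in the unit ball and any [z], the projection of [z] onto
    [V = range T] is [adjoint T w] for some [w], so that the inner product of
    [z] with [X y] equals that of [w] with [T (X y)], and is at most [nrm w].
    The vectors [X y] are thus weakly bounded, hence bounded. *)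
Lemma bounded_inverse_on_range T X P : bounded_operator T ->
    (forall x, range (adjoint T) (P x)) ->
    (forall x y, dotp (P x) y = dotp x (P y)) ->
    (forall x, nrm (P x) <= nrm x) ->
    linear X -> (forall y, P (X y) = X y) -> (forall y, T (X y) = P y) ->
  bounded_operator X.
Proof.
move=> bT VP dP nP lX PX TX; have [_ aT] := adjointP bT.
have [X0 _ _ XZ] := linear_morph lX.
have [|C XC] := @uniform_boundedness _ _ [set X y | y in [set y | nrm y <= 1]].
  move=> z; have [w _ wz] := VP z; exists (nrm w) => _ [y /= y1 <-].
  have -> : rdot z (X y) = rdot w (P y).
    by rewrite /rdot -PX -dP -wz -(TX y) dotpC -aT -dotpC.
  rewrite (le_trans (rdot_CauchySchwarz _ _)) // -[leRHS]mulr1.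
  by rewrite ler_wpM2l ?nrm_ge0 // (le_trans (nP y)).
apply/boundedP; split=> //; exists `|C| => // x.
have [->|x0] := eqVneq x 0; first by rewrite X0 nrm0 mulr0.
have nx := nrm_gt0 x0.
have : nrm (X ((nrm x)^-1%:C%C *: x)) <= C.
  apply: XC; exists ((nrm x)^-1%:C%C *: x) => //=.
  by rewrite nrmZ ger0_norm ?invr_ge0 ?nrm_ge0 // mulVf // gt_eqF.
rewrite XZ nrmZ ger0_norm ?invr_ge0 ?nrm_ge0 // ler_pdivrMl // mulrC.
by move=> /le_trans; apply; rewrite ler_wpM2r ?nrm_ge0 ?ler_norm.
Qed.

(** Let [P] be the orthogonal projection onto [V = range T]. As [range T] is
    also the range of the adjoint, the kernel of [T] is the orthogonal complement
    of [V], so [T] restricts to a bijection of [V]. The vector [X y] is the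
    preimage of [P y] under it, and both products [T X] and [X T] are [P]. *)
Lemma EP_inverse T : bounded_operator T -> EP T ->
  exists X, is_MP_inverse T X /\ T \o X = X \o T.
Proof.
move=> bT [cT rT].
have [lT _] := bT; have [T0 TD TB TZ] := linear_morph lT.
have [V0 VL] := range_subspace lT; set V := range T in cT rT V0 VL.
have VB x y : V x -> V y -> V (x - y).
  by move=> Vx Vy; rewrite addrC -scaleN1r; apply: VL.
have ker x : T x = 0 <-> forall v, V v -> dotp x v = 0.
  by rewrite rT; apply: kernel_orthogonal_range_adjoint.
have kerV x : V x -> T x = 0 -> x = 0.
  by move=> Vx /ker/(_ x Vx)/eqP; rewrite dnorm_eq0 => /eqP.
have [P [VP PV oP dP nP]] := orthogonal_projector cT V0 VL.
have TP x : T (P x) = T x.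
  by apply/esym/eqP; rewrite -subr_eq0 -TB; apply/eqP/ker/oP.
have /choice[X hX] y : exists s, V s /\ T s = P y.
  by have [x _ xP] := VP y; exists (P x); split; rewrite ?TP.
have VX y : V (X y) by case: (hX y).
have TX y : T (X y) = P y by case: (hX y).
have XT x : X (T x) = P x.
  apply/eqP; rewrite -subr_eq0; apply/eqP/kerV; first exact: VB.
  by rewrite TB TX TP PV ?subrr //; exists x.
have lX : linear X.
  move=> a x y; apply/eqP; rewrite -subr_eq0; apply/eqP/kerV.
    by apply: VB => //; apply: VL.
  rewrite TB lT !TX; apply/eqP; rewrite subr_eq0; apply/eqP.
  by apply: dotp_inj => z; rewrite -dP !linearDr /= !dotpZr !dP.
have bX : bounded_operator X.
  apply: (bounded_inverse_on_range bT _ dP nP lX) => // [x|y]; last exact: PV.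
  by rewrite -rT.
have TXP : T \o X = P by apply: funext => y /=.
have XTP : X \o T = P by apply: funext => y /=.
have aP : adjoint P = P.
  by apply: adjoint_uniq => //; rewrite -XTP; apply: bounded_comp.
exists X; split; last by rewrite TXP XTP.
split=> //; rewrite ?TXP ?XTP //.
- by apply: funext => x /=; apply: PV; exists x.
- by apply: funext => x /=; apply: PV.
Qed.

(** Penrose's argument: [T X = (T Y) (T X)] is a product of two self-adjoint
    operators, whose adjoint is [(T X) (T Y) = T Y]; similarly [X T = Y T], and
    therefore [X = (X T) X = Y (T X) = Y (T Y) = Y]. *)
Lemma MP_inverse_uniq T X Y : bounded_operator T ->
  is_MP_inverse T X -> is_MP_inverse T Y -> X = Y.
Proof.
move=> bT [bX TXT XTX aTX aXT] [bY TYT YTY aTY aYT].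
have TXY : T \o X = T \o Y.
  rewrite -aTX -[in LHS]TYT.
  have -> : T \o Y \o T \o X = (T \o Y) \o (T \o X) by [].
  rewrite adjoint_comp ?aTX ?aTY; try exact: bounded_comp.
  have -> : (T \o X) \o (T \o Y) = (T \o X \o T) \o Y by [].
  by rewrite TXT.
have XYT : X \o T = Y \o T.
  rewrite -aYT -[in RHS]TXT.
  have -> : Y \o (T \o X \o T) = (Y \o T) \o (X \o T) by [].
  rewrite adjoint_comp ?aXT ?aYT; try exact: bounded_comp.
  have -> : (X \o T) \o (Y \o T) = X \o (T \o Y \o T) by [].
  by rewrite TYT.
rewrite -XTX XYT; have -> : Y \o T \o X = Y \o (T \o X) by [].
by rewrite TXY.
Qed.

Lemma MP_inverseP T : bounded_operator T -> EP T ->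
  is_MP_inverse T (MP_inverse T) /\ T \o MP_inverse T = MP_inverse T \o T.
Proof.
move=> bT eT; have [X [hX c]] := EP_inverse bT eT.
suff -> : MP_inverse T = X by [].
apply: (MP_inverse_uniq bT _ hX).
by apply: (@getPex _ (is_MP_inverse T)); exists X.
Qed.

Lemma MP_inverse_adjoint T : bounded_operator T -> EP T ->
  MP_inverse (adjoint T) = adjoint (MP_inverse T).
Proof.
move=> bT eT; have [bA _] := adjointP bT.
have [[bX TXT XTX aTX aXT] _] := MP_inverseP bT eT.
have [bAX _] := adjointP bX.
apply: (MP_inverse_uniq bA (MP_inverseP bA (EP_adjoint bT eT)).1).
split=> //; rewrite -!adjoint_comp ?aTX ?aXT ?TXT ?XTX //;
  try exact: bounded_comp.
- by rewrite -[in RHS]TXT.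
- by rewrite -[in RHS]XTX.
Qed.

End MoorePenrose.

(** * Reverse order law for nested ranges *)

Section ReverseOrderLaw.
Context {R : realType} {H : hilbertType R}.
Implicit Types (A B T : H -> H).

Lemma EP_projection_range T x : bounded_operator T -> EP T -> range T x ->
  T (MP_inverse T x) = x.
Proof.
move=> bT eT [z _ <-]; have [[_ TXT _ _ _] _] := MP_inverseP bT eT.
exact: (congr1 (fun f => f z) TXT).
Qed.

Lemma EP_MP_inverseC T x : bounded_operator T -> EP T ->
  T (MP_inverse T x) = MP_inverse T (T x).
Proof.
move=> bT eT; have [_ c] := MP_inverseP bT eT.
exact: (congr1 (fun f => f x) c).
Qed.

Lemma EP_range_MP_inverse T x : bounded_operator T -> EP T ->
  range T (MP_inverse T x).
Proof.
move=> bT eT; have [[_ _ XTX _ _] _] := MP_inverseP bT eT.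
exists (MP_inverse T (MP_inverse T x)) => //.
rewrite EP_MP_inverseC //; exact: (congr1 (fun f => f x) XTX).
Qed.

Lemma EP_projection_symmetric T x y : bounded_operator T -> EP T ->
  dotp (T (MP_inverse T x)) y = dotp x (T (MP_inverse T y)).
Proof.
move=> bT eT; have [[bX _ _ aTX _] _] := MP_inverseP bT eT.
have [_ h] := adjointP (bounded_comp bT bX).
by have := h x y; rewrite aTX.
Qed.

(** Let [Q = (B' A') (A B)], so that [dotp (M (Q x)) y = dotp (Q x) (M y)].
    In [dotp (Q x) (M1 y)], where [M1 y] is the adjoint of [B] applied to some
    [A z], the projections [B B'] and [A A'] meet only vectors of [range A] and
    can be dropped, which leaves [dotp x (M1 y)]. In [dotp (Q x) (M2 y)],
    moving [B'] and [A A'] to the right annihilates [M2 y]. *)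
Lemma MP_inverse_product_weight A B (M M1 M2 : H -> H) :
  bounded_operator A -> bounded_operator B -> EP A -> EP B ->
  range A `<=` range B ->
  positive_operator M -> positive_operator M1 -> M = M1 \+ M2 ->
  range M1 `<=` range (adjoint B \o A) ->
  range M2 `<=` nullspace (A \o MP_inverse (adjoint B)) ->
  M \o (MP_inverse B \o MP_inverse A) \o (A \o B) = M1.
Proof.
move=> bA bB eA eB AB pM pM1 MD rM1 rM2.
have [_ aB] := adjointP bB; have [[bB' _ _ _ _] _] := MP_inverseP bB eB.
have [[bA' _ _ _ _] _] := MP_inverseP bA eA.
have [A'0 _ _ _] := linear_morph bA'.1.
have [_ aB'] := adjointP bB'.
apply: funext => x; apply: dotp_inj => y /=.
rewrite dotpC [RHS]dotpC; congr (_^*%R).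
rewrite (positive_symmetric pM) (positive_symmetric pM1) MD linearDr /=.
have [z _ z1] : range (adjoint B \o A) (M1 y) by apply: rM1; exists y.
have M2y : A (adjoint (MP_inverse B) (M2 y)) = 0.
  by rewrite -MP_inverse_adjoint //; apply: rM2; exists y.
have BB'A u : B (MP_inverse B (A u)) = A u.
  by apply: EP_projection_range => //; apply: AB; exists u.
have AA'z : A (MP_inverse A (A z)) = A z.
  by apply: EP_projection_range => //; exists z.
rewrite -EP_MP_inverseC // [X in _ + X](_ : _ = 0).
  by rewrite addr0 -z1 /= -!aB BB'A EP_projection_symmetric // AA'z.
by rewrite aB' EP_projection_symmetric // EP_MP_inverseC // M2y A'0 linear0r.
Qed.

End ReverseOrderLaw.

Unset Implicit Arguments.

Theorem theorem5p15 (R : realType) (H : hilbertType R) (A B : H -> H) :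
  bounded_operator A -> bounded_operator B ->
  EP A -> EP B ->
  range A `<=` range B ->
  forall M M1 M2 : H -> H,
    positive_operator M -> positive_operator M1 -> positive_operator M2 ->
    M = M1 \+ M2 ->
    range M1 `<=` range (adjoint B \o A) ->
    range M2 `<=` nullspace (A \o MP_inverse (adjoint B)) ->
    is_weighted_ginv idfun M (A \o B) (MP_inverse B \o MP_inverse A).
Proof.
move=> bA bB eA eB AB M M1 M2 pM pM1 pM2 MD rM1 rM2.
have [[bA' AA'A A'AA' aAA' _] _] := MP_inverseP bA eA.
have [[bB' _ _ _ _] _] := MP_inverseP bB eB.
have BB'A' x : B (MP_inverse B (MP_inverse A x)) = MP_inverse A x.
  by apply: EP_projection_range => //; apply: AB; apply: EP_range_MP_inverse.
have TX : (A \o B) \o (MP_inverse B \o MP_inverse A) = A \o MP_inverse A.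
  by apply: funext => x /=; rewrite BB'A'.
have rAB : range (A \o B) = range A.
  apply/seteqP; split=> [_ [x _ <-]|_ [x _ <-]]; first by exists (B x).
  exists (MP_inverse B (MP_inverse A (A x))) => //=.
  by rewrite BB'A'; exact: (congr1 (fun f => f x) AA'A).
split.
- split; last by move=> x; apply: dnorm_ge0.
  by apply/boundedP; split => //; exists 1 => // x; rewrite mul1r.
- exact: pM.
- exact: bounded_comp.
- by rewrite rAB; case: eA.
- exact: bounded_comp.
- rewrite TX; exact: (congr1 (fun f => f \o B) AA'A).
- set X := MP_inverse B \o MP_inverse A in TX *.
  rewrite -[LHS]/(X \o (A \o B \o X)) TX.
  exact: (congr1 (fun f => MP_inverse B \o f) A'AA').
- by rewrite -[idfun \o _ \o _]/(A \o B \o (MP_inverse B \o MP_inverse A)) TX.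
- rewrite (MP_inverse_product_weight bA bB eA eB AB pM pM1 MD rM1 rM2).
  by apply: adjoint_uniq; [case: pM1 | exact: positive_symmetric].
Qed.
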